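(* Let $c>0$, let $a,b>0$ with $a\neq b$, and let $\Omega=(-a,b)$ be decomposed into $\Omega_1=(-a,0)$ and $\Omega_2=(0,b)$. Let $\theta=\frac12$. If $k\ge1$ is an integer and the time window length $T>0$ satisfies $$\frac{T}{k}\le 2\min\left\{\frac ac,\frac bc\right\},$$ then the DNWR algorithm on $\Omega\times(0,T)$ (defined in the context) converges in at most $k+1$ iterations.
   Context: Model problem in one space dimension with wave speed $c>0$: $\partial_{tt}u-c^2\partial_{xx}u=f(x,t)$ for $x\in\Omega=(-a,b)$, $0<t<T$; $u(x,0)=u_0(x)$, $u_t(x,0)=v_0(x)$ for $x\in\Omega$; $u(x,t)=g(x,t)$ for $x\in\{-a,b\}$, $0<t<T$. The domain is split into $\Omega_1=(-a,0)$ and $\Omega_2=(0,b)$, with interface at $x=0$. The data and initial guesses are assumed regular and compatible enough that all problems below are uniquely solvable and the interface traces and derivatives are well defined. Dirichlet-Neumann Waveform Relaxation (DNWR) with relaxation parameter $\theta\in(0,1]$: given an initial guess $h^0(t)$, $t\in(0,T)$, for iterations $j=1,2,\ldots$ compute first $u_1^j$ on $\Omega_1\times(0,T)$ from $\partial_{tt}u_1^j-c^2\partial_{xx}u_1^j=f$, $u_1^j(x,0)=u_0(x)$, $\partial_tu_1^j(x,0)=v_0(x)$, $u_1^j(-a,t)=g(-a,t)$, $u_1^j(0,t)=h^{j-1}(t)$; then $u_2^j$ on $\Omega_2\times(0,T)$ from $\partial_{tt}u_2^j-c^2\partial_{xx}u_2^j=f$, $u_2^j(x,0)=u_0(x)$,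 $\partial_tu_2^j(x,0)=v_0(x)$, $\partial_xu_2^j(0,t)=\partial_xu_1^j(0,t)$, $u_2^j(b,t)=g(b,t)$; then update $h^j(t)=\theta u_2^j(0,t)+(1-\theta)h^{j-1}(t)$. The algorithm converges in at most $m$ iterations if, for every initial guess $h^0$, $u_i^m$ equals the exact solution $u$ on $\Omega_i\times(0,T)$ for $i=1,2$. *)

(* Defs.v *)
From Stdlib Require Import Reals.
From Coquelicot Require Import Coquelicot.
Open Scope R_scope.

Definition Ioo (l r x : R) : Prop := l < x < r.
Definition Icc (l r x : R) : Prop := l <= x <= r.
Definition Ico (l r x : R) : Prop := l <= x < r.

(* [u] is C^1 on I x J with partial derivatives [ux] and [ut].  Derivatives are
   relative to I and J (difference quotients inside the set, via [D_in]), hence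
   one-sided at an end point belonging to the interval; the values of [u]
   outside I x J are irrelevant. *)
Definition C1_on (I J : R -> Prop) (u ux ut : R -> R -> R) : Prop :=
  (forall x t, I x -> J t ->
     D_in (fun y => u y t) (fun y => ux y t) I x /\
     D_in (fun s => u x s) (fun s => ut x s) J t) /\
  continuous_on (fun p : R * R => I (fst p) /\ J (snd p))
                (fun p => ux (fst p) (snd p)) /\
  continuous_on (fun p : R * R => I (fst p) /\ J (snd p))
                (fun p => ut (fst p) (snd p)).

(* Classical solution on (l, r) x (0, T) of the wave equation with its initial
   conditions: C^1 on [l, r] x [0, T) and C^2 in (l, r) x (0, T).  The first
   derivatives [ux], [ut] are exposed so that the initial velocity and the
   interface fluxes can be read off on the boundary. *)
Definition wave_solution (c l r T : R) (f : R -> R -> R) (u0 v0 : R -> R)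
    (u ux ut : R -> R -> R) : Prop :=
  C1_on (Icc l r) (Ico 0 T) u ux ut /\
  (exists uxx uxt utx utt : R -> R -> R,
     C1_on (Ioo l r) (Ioo 0 T) ux uxx uxt /\
     C1_on (Ioo l r) (Ioo 0 T) ut utx utt /\
     (forall x t, l < x < r -> 0 < t < T ->
        utt x t - c ^ 2 * uxx x t = f x t)) /\
  (forall x, l < x < r -> u x 0 = u0 x /\ ut x 0 = v0 x).

Definition exact_solution (c a b T : R) (f g : R -> R -> R) (u0 v0 : R -> R)
    (u : R -> R -> R) : Prop :=
  (exists ux ut : R -> R -> R, wave_solution c (- a) b T f u0 v0 u ux ut) /\
  (forall t, 0 < t < T -> u (- a) t = g (- a) t /\ u b t = g b t).

(* One iteration: from the interface trace [h] to the subdomain solutions [u1],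
   [u2] and the relaxed trace [h']. *)
Definition DNWR_step (c a b T theta : R) (f g : R -> R -> R) (u0 v0 : R -> R)
    (h : R -> R) (u1 u2 : R -> R -> R) (h' : R -> R) : Prop :=
  exists u1x u1t u2x u2t : R -> R -> R,
    wave_solution c (- a) 0 T f u0 v0 u1 u1x u1t /\
    (forall t, 0 < t < T -> u1 (- a) t = g (- a) t /\ u1 0 t = h t) /\
    wave_solution c 0 b T f u0 v0 u2 u2x u2t /\
    (forall t, 0 < t < T -> u2x 0 t = u1x 0 t /\ u2 b t = g b t) /\
    (forall t, 0 < t < T -> h' t = theta * u2 0 t + (1 - theta) * h t).

(* The initial guess is [h 0]; it ranges over all functions for which the first
   [m] iterations have classical solutions. *)
Definition DNWR_converges_in_at_most (m : nat) (c a b T theta : R)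
    (f g : R -> R -> R) (u0 v0 : R -> R) (u : R -> R -> R) : Prop :=
  forall (h : nat -> R -> R) (u1 u2 : nat -> R -> R -> R),
    (forall j, (1 <= j <= m)%nat ->
       DNWR_step c a b T theta f g u0 v0 (h (j - 1)%nat) (u1 j) (u2 j) (h j)) ->
    (forall x t, - a < x < 0 -> 0 < t < T -> u1 m x t = u x t) /\
    (forall x t, 0 < x < b -> 0 < t < T -> u2 m x t = u x t).

(* Main.v *)
Require Import Defs.
From Stdlib Require Import Reals Lra Lia.
From Coquelicot Require Import Coquelicot.
Open Scope R_scope.

(* The errors [e1 = u1 - u], [e2 = u2 - u] solve the homogeneous wave equation
   with zero initial and outer boundary data, so each Riemann invariant
   [et + d * ex], [d = c] or [d = - c], is constant along its characteristics.
   At the interface the invariant coming back from the outer boundary is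
   therefore minus the outgoing one delayed by [2 a / c] (resp. [2 b / c]), or
   zero before that time.  If the interface error is stationary (hence zero) up
   to time [s], then so are the outgoing invariants, and the returning ones
   vanish up to [s + 2 min (a / c) (b / c)].  Since the fluxes agree, the time
   derivative of the updated trace with [theta = 1 / 2] is the half sum of the
   returning invariants: each iteration gains [2 min (a / c) (b / c)], so [k] of
   them cover the window, and one more gives the exact solution. *)

(** * One-sided derivatives, clamping and functions with null derivative *)

Lemma D_in_continuous_on (D : R -> Prop) (f df : R -> R) :
  (forall x, D x -> D_in f df D x) -> continuous_on D f.
Proof.
  intros H x Dx P [eps HP].
  destruct (cont_deriv _ _ _ _ (H x Dx) eps (cond_pos eps)) as [al [al0 Hal]].
  exists (mkposreal al al0). intros y Hy Dy. apply HP.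
  destruct (Req_dec x y) as [<- | ne]; [apply ball_center |].
  apply Hal. split; [split; [exact Dy | exact ne] | exact Hy].
Qed.

Lemma D_in_is_derive (D : R -> Prop) (f df : R -> R) (x : R) :
  locally x D -> D_in f df D x -> is_derive f x (df x).
Proof.
  intros [del Hdel] H. apply is_derive_Reals, derivable_pt_lim_D_in.
  intros eps eps0. destruct (H eps eps0) as [al [al0 Hal]].
  exists (Rmin al del). split; [apply Rmin_glb_lt; [exact al0 | apply cond_pos] |].
  intros y [[_ ne] Hy]. apply Hal. repeat split; try assumption.
  - apply Hdel. exact (Rlt_le_trans _ _ _ Hy (Rmin_r _ _)).
  - exact (Rlt_le_trans _ _ _ Hy (Rmin_l _ _)).
Qed.

Lemma clamp_bounds (A B s : R) : A <= B -> A <= Rmax A (Rmin B s) <= B.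
Proof.
  intros AB. split; [apply Rmax_l |].
  apply Rmax_lub; [exact AB | apply Rmin_l].
Qed.

Lemma clamp_id (A B s : R) : A <= s <= B -> Rmax A (Rmin B s) = s.
Proof. intros H. rewrite Rmin_right, Rmax_right; lra. Qed.

(** Clamping is 1-Lipschitz with values in [[A, B]], so it turns continuity relative to [[A, B]]
    into two-sided continuity on the whole line. *)
Lemma continuous_clamp (A B : R) (f : R -> R) (s : R) :
  A <= B -> continuous_on (Icc A B) f ->
  continuous (fun s => f (Rmax A (Rmin B s))) s.
Proof.
  intros AB Hf.
  apply filterlim_comp with (2 := Hf _ (clamp_bounds A B s AB)).
  intros P [eps HP]. exists eps. intros y Hy.
  apply HP; [| apply clamp_bounds, AB].
  refine (Rle_lt_trans _ _ _ _ Hy). unfold abs, minus, plus, opp; simpl.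
  unfold Rmax, Rmin, Rabs; repeat destruct Rle_dec; repeat destruct Rcase_abs; lra.
Qed.

(** Mean value theorem for the clamped function, which agrees with [f] on [[A, B]]. It serves paths
    whose end points lie on the boundary of the domain, where only relative continuity is
    available. *)
Lemma null_derivative_continuous_on (A B : R) (f : R -> R) :
  A <= B -> continuous_on (Icc A B) f ->
  (forall s, A < s < B -> is_derive f s 0) -> f A = f B.
Proof.
  intros AB Hf Hd.
  destruct (MVT_gen (fun s => f (Rmax A (Rmin B s))) A B (fun _ => 0)) as [x [_ Hx]].
  - rewrite Rmin_left, Rmax_right by exact AB. intros s Hs.
    apply is_derive_ext_loc with (2 := Hd s Hs).
    apply filter_imp with (Ioo A B).
    + intros y Hy. symmetry. f_equal. apply clamp_id. unfold Ioo in Hy; lra.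
    + apply (open_and _ _ (open_gt A) (open_lt B)). exact Hs.
  - intros s _. apply continuity_pt_filterlim, continuous_clamp; assumption.
  - rewrite !clamp_id in Hx by lra. lra.
Qed.

(** * Restriction and superposition of solutions *)

Lemma C1_on_subset (I J I' J' : R -> Prop) (u ux ut : R -> R -> R) :
  (forall x, I' x -> I x) -> (forall t, J' t -> J t) ->
  C1_on I J u ux ut -> C1_on I' J' u ux ut.
Proof.
  intros HI HJ [Hd [Hx Ht]]. split; [| split].
  - intros x t Ix Jt. destruct (Hd x t (HI x Ix) (HJ t Jt)).
    split; [apply D_in_imp with I | apply D_in_imp with J]; assumption.
  - eapply continuous_on_subset; [| exact Hx]. intros p []; split; auto.
  - eapply continuous_on_subset; [| exact Ht]. intros p []; split; auto.
Qed.

Lemma continuous_on_plus_mult (D : R * R -> Prop) (f g : R * R -> R) (k : R) :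
  continuous_on D f -> continuous_on D g ->
  continuous_on D (fun p => f p + k * g p).
Proof.
  intros Hf Hg p Dp.
  apply (filterlim_comp_2 _ _ _ (Hf p Dp)
    (filterlim_comp _ _ _ _ _ _ _ _ (Hg p Dp) (filterlim_scal_r k (g p)))
    (filterlim_plus (f p) (k * g p))).
Qed.

Lemma C1_on_minus (I J : R -> Prop) (u ux ut w wx wt : R -> R -> R) :
  C1_on I J u ux ut -> C1_on I J w wx wt ->
  C1_on I J (fun x t => u x t - w x t) (fun x t => ux x t - wx x t)
    (fun x t => ut x t - wt x t).
Proof.
  intros [Hd [Hx Ht]] [Kd [Kx Kt]]. split; [| split].
  - intros x t Ix Jt.
    destruct (Hd x t Ix Jt), (Kd x t Ix Jt). split; apply Dminus; assumption.
  - apply continuous_on_ext with (2 := continuous_on_plus_mult _ _ _ (-1) Hx Kx).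
    intros p _. refine (_ : @eq R _ _). ring.
  - apply continuous_on_ext with (2 := continuous_on_plus_mult _ _ _ (-1) Ht Kt).
    intros p _. refine (_ : @eq R _ _). ring.
Qed.

Lemma wave_solution_minus (c l r T : R) (f : R -> R -> R) (u0 v0 : R -> R)
    (u ux ut w wx wt : R -> R -> R) :
  wave_solution c l r T f u0 v0 u ux ut ->
  wave_solution c l r T f u0 v0 w wx wt ->
  wave_solution c l r T (fun _ _ => 0) (fun _ => 0) (fun _ => 0)
    (fun x t => u x t - w x t) (fun x t => ux x t - wx x t)
    (fun x t => ut x t - wt x t).
Proof.
  intros [HC [(uxx & uxt & utx & utt & Hx & Ht & He) Hi]]
    [KC [(wxx & wxt & wtx & wtt & Kx & Kt & Ke) Ki]].
  split; [apply C1_on_minus; assumption | split].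
  - exists (fun x t => uxx x t - wxx x t), (fun x t => uxt x t - wxt x t),
      (fun x t => utx x t - wtx x t), (fun x t => utt x t - wtt x t).
    split; [| split]; try (apply C1_on_minus; assumption).
    intros y s Iy Js. specialize (He y s Iy Js). specialize (Ke y s Iy Js). lra.
  - intros x Ix. destruct (Hi x Ix), (Ki x Ix). split; lra.
Qed.

Lemma wave_solution_restrict (c l r l' r' T : R) (f : R -> R -> R)
    (u0 v0 : R -> R) (u ux ut : R -> R -> R) :
  l <= l' -> r' <= r ->
  wave_solution c l r T f u0 v0 u ux ut ->
  wave_solution c l' r' T f u0 v0 u ux ut.
Proof.
  intros Hl Hr [HC [(uxx & uxt & utx & utt & Hx & Ht & He) Hi]].
  split; [| split].
  - apply C1_on_subset with (3 := HC); unfold Icc; intros; assumption || lra.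
  - exists uxx, uxt, utx, utt.
    split; [| split].
    + apply C1_on_subset with (3 := Hx); unfold Ioo; intros; lra.
    + apply C1_on_subset with (3 := Ht); unfold Ioo; intros; lra.
    + intros; apply He; lra.
  - intros; apply Hi; lra.
Qed.

(** * Differential calculus on open rectangles *)

Lemma locally_Ioo (l r x : R) : Ioo l r x -> locally x (Ioo l r).
Proof. apply (open_and _ _ (open_gt l) (open_lt r)). Qed.

Lemma locally_rectangle (l r l' r' x t : R) : Ioo l r x -> Ioo l' r' t ->
  locally (x, t) (fun p => Ioo l r (fst p) /\ Ioo l' r' (snd p)).
Proof.
  intros [e1 H1]%locally_Ioo [e2 H2]%locally_Ioo.
  assert (e0 : 0 < Rmin e1 e2) by (apply Rmin_glb_lt; apply cond_pos).
  exists (mkposreal _ e0). intros y [Hx Ht]. split.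
  - apply H1. exact (Rlt_le_trans _ _ _ Hx (Rmin_l _ _)).
  - apply H2. exact (Rlt_le_trans _ _ _ Ht (Rmin_r _ _)).
Qed.

Lemma C1_on_is_derive (l r l' r' : R) (u ux ut : R -> R -> R) (x t : R) :
  C1_on (Ioo l r) (Ioo l' r') u ux ut -> Ioo l r x -> Ioo l' r' t ->
  is_derive (fun y => u y t) x (ux x t) /\ is_derive (fun s => u x s) t (ut x t).
Proof.
  intros [H _] Ix Jt. destruct (H x t Ix Jt) as [Hx Ht]. split.
  - apply (D_in_is_derive _ _ (fun y => ux y t) _ (locally_Ioo l r x Ix) Hx).
  - apply (D_in_is_derive _ _ (ut x) _ (locally_Ioo l' r' t Jt) Ht).
Qed.

(** Chain rule: both partial derivatives exist and [ux] is continuous, so [u] is differentiable as a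
    function of two variables and can be composed with the path. *)
Lemma C1_on_is_derive_path (l r l' r' : R) (u ux ut : R -> R -> R)
    (X S : R -> R) (dX dS s : R) :
  C1_on (Ioo l r) (Ioo l' r') u ux ut ->
  Ioo l r (X s) -> Ioo l' r' (S s) -> is_derive X s dX -> is_derive S s dS ->
  is_derive (fun s => u (X s) (S s)) s (dX * ux (X s) (S s) + dS * ut (X s) (S s)).
Proof.
  intros HC Ix Jt HX HS.
  assert (Hf : filterdiff (fun p => u (fst p) (snd p)) (locally (X s, S s))
    (fun p => plus (scal (fst p) (ux (X s) (S s))) (scal (snd p) (ut (X s) (S s))))).
  { apply is_derive_filterdiff.
    - apply filter_imp with (2 := locally_rectangle _ _ _ _ _ _ Ix Jt).
      intros p [Px Pt]. exact (proj1 (C1_on_is_derive _ _ _ _ _ _ _ _ _ HC Px Pt)).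
    - exact (proj2 (C1_on_is_derive _ _ _ _ _ _ _ _ _ HC Ix Jt)).
    - apply continuous_continuous_on with (2 := proj1 (proj2 HC)).
      apply locally_rectangle; assumption. }
  destruct (filterdiff_comp'_2 X S u s _ _
    (fun y z => plus (scal y (ux (X s) (S s))) (scal z (ut (X s) (S s)))) HX HS Hf)
    as [_ H2].
  split; [apply is_linear_scal_l |].
  intros y Hy eps. apply filter_imp with (2 := H2 y Hy eps).
  intros z Hz. eapply Rle_trans; [| exact Hz]. right. f_equal. f_equal.
  unfold minus, plus, scal, opp; simpl. unfold mult; simpl. ring.
Qed.

(** Schwarz's theorem. The second derivatives are given as functions, so they are first identified
    near the point with iterated [Derive], whose continuity then comes from that of [utx] and
    [uxt]. *)
Lemma C1_on_mixed_partials (l r l' r' : R)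
    (u ux ut uxx uxt utx utt : R -> R -> R) (x t : R) :
  C1_on (Ioo l r) (Ioo l' r') u ux ut ->
  C1_on (Ioo l r) (Ioo l' r') ux uxx uxt ->
  C1_on (Ioo l r) (Ioo l' r') ut utx utt ->
  Ioo l r x -> Ioo l' r' t -> uxt x t = utx x t.
Proof.
  intros HC HX HT Ix Jt.
  assert (Htx : forall y s, Ioo l r y -> Ioo l' r' s ->
    is_derive (fun z => Derive (fun s => u z s) s) y (utx y s)).
  { intros y s Iy Js.
    apply is_derive_ext_loc with (2 := proj1 (C1_on_is_derive _ _ _ _ _ _ _ _ _ HT Iy Js)).
    apply filter_imp with (2 := locally_Ioo _ _ _ Iy). intros z Iz.
    symmetry. apply is_derive_unique, (C1_on_is_derive _ _ _ _ _ _ _ _ _ HC Iz Js). }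
  assert (Hxt : forall y s, Ioo l r y -> Ioo l' r' s ->
    is_derive (fun z => Derive (fun y => u y z) y) s (uxt y s)).
  { intros y s Iy Js.
    apply is_derive_ext_loc with (2 := proj2 (C1_on_is_derive _ _ _ _ _ _ _ _ _ HX Iy Js)).
    apply filter_imp with (2 := locally_Ioo _ _ _ Js). intros z Jz.
    symmetry. apply is_derive_unique, (C1_on_is_derive _ _ _ _ _ _ _ _ _ HC Iy Jz). }
  assert (Hloc := locally_rectangle _ _ _ _ _ _ Ix Jt).
  rewrite <- (is_derive_unique _ _ _ (Htx x t Ix Jt)).
  rewrite <- (is_derive_unique _ _ _ (Hxt x t Ix Jt)).
  symmetry. apply (Schwarz u x t).
  - apply locally_2d_locally. apply filter_imp with (2 := Hloc).
    intros [y s] [Iy Js]; simpl in *.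
    destruct (C1_on_is_derive _ _ _ _ _ _ _ _ _ HC Iy Js).
    repeat split; eexists; eauto.
  - apply continuity_2d_pt_ext_loc with utx.
    + apply locally_2d_locally. apply filter_imp with (2 := Hloc).
      intros [y s] [Iy Js]; simpl in *. symmetry. apply is_derive_unique; auto.
    + apply continuity_2d_pt_filterlim.
      apply continuous_continuous_on with (1 := Hloc), HT.
  - apply continuity_2d_pt_ext_loc with uxt.
    + apply locally_2d_locally. apply filter_imp with (2 := Hloc).
      intros [y s] [Iy Js]; simpl in *. symmetry. apply is_derive_unique; auto.
    + apply continuity_2d_pt_filterlim.
      apply continuous_continuous_on with (1 := Hloc), HX.
Qed.

(** * Riemann invariants along characteristics *)

Definition homogeneous_wave (c l r T : R) (u ux ut : R -> R -> R) : Prop :=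
  wave_solution c l r T (fun _ _ => 0) (fun _ => 0) (fun _ => 0) u ux ut.

(** Comes from the factorization [utt - d ^ 2 * uxx = (dt - d * dx) (ut + d * ux)]: going back in
    time, the quantity is carried towards [x + d * s], so the sign of [d] tells from which side it
    arrives. *)
Definition riemann (ux ut : R -> R -> R) (d x t : R) : R := ut x t + d * ux x t.

(** The path is affine with arbitrary slopes so as to cover both a characteristic ([t' = -1]) and
    the initial line ([t' = 0]). *)
Lemma continuous_on_riemann (I J : R -> Prop) (u ux ut : R -> R -> R)
    (d x t x' t' A B : R) :
  C1_on I J u ux ut ->
  (forall s, A <= s <= B -> I (x + x' * s) /\ J (t + t' * s)) ->
  continuous_on (Icc A B) (fun s => riemann ux ut d (x + x' * s) (t + t' * s)).
Proof.
  intros [_ [Hx Ht]] Hs s Is.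
  assert (Haff : forall y y', continuous (fun s => y + y' * s) s).
  { intros y y'. apply (ex_derive_continuous (fun s => y + y' * s)). now auto_derive. }
  refine (filterlim_comp _ _ _ (fun s => (x + x' * s, t + t' * s)) _ _ _ _ _
    (continuous_on_plus_mult _ _ _ d Ht Hx (x + x' * s, t + t' * s) (Hs s Is))).
  intros P [eps HP].
  assert (Hball := filter_and (F := locally s)
    (fun y => ball (x + x' * s) eps (x + x' * y))
    (fun y => ball (t + t' * s) eps (t + t' * y))
    (Haff x x' _ (locally_ball _ eps)) (Haff t t' _ (locally_ball _ eps))).
  apply filter_imp with (2 := Hball).
  intros y Hy Iy. exact (HP (_, _) Hy (Hs y Iy)).
Qed.

(** Along the backward characteristic the derivative is [d ^ 2 * uxx - utt] once the mixed partials
    are identified, hence zero. Its end points may lie on the boundary, but the open segment is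
    inside the domain, where the equation holds. *)
Lemma riemann_transport (c l r T : R) (u ux ut : R -> R -> R) (d x t tau : R) :
  homogeneous_wave c l r T u ux ut -> d ^ 2 = c ^ 2 -> d <> 0 ->
  Icc l r x -> Icc l r (x + d * tau) -> 0 <= tau <= t -> t < T ->
  riemann ux ut d x t = riemann ux ut d (x + d * tau) (t - tau).
Proof.
  intros [HC [(uxx & uxt & utx & utt & Hx & Ht & He) _]] Hdc Hd Ix Iy Htau HtT.
  unfold Icc in *.
  set (phi s := riemann ux ut d (x + d * s) (t + -1 * s)).
  assert (Hphi : phi 0 = phi tau).
  { apply null_derivative_continuous_on; [lra | |].
    - apply continuous_on_riemann with (1 := HC). unfold Icc, Ico.
      intros s Hs. destruct (Rdichotomy _ _ Hd); split; nra.
    - intros s Hs.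
      assert (Is : Ioo l r (x + d * s))
        by (unfold Ioo; destruct (Rdichotomy _ _ Hd); nra).
      assert (Js : Ioo 0 T (t + -1 * s)) by (unfold Ioo; lra).
      assert (Hp : forall v vx vt, C1_on (Ioo l r) (Ioo 0 T) v vx vt ->
        is_derive (fun s => v (x + d * s) (t + -1 * s)) s
          (d * vx (x + d * s) (t + -1 * s) + -1 * vt (x + d * s) (t + -1 * s))).
      { intros v vx vt Hv.
        apply (C1_on_is_derive_path l r 0 T v vx vt
          (fun s => x + d * s) (fun s => t + -1 * s)); try assumption;
          auto_derive; trivial; ring. }
      assert (Hm : uxt (x + d * s) (t + -1 * s) = utx (x + d * s) (t + -1 * s)).
      { apply (C1_on_mixed_partials l r 0 T u ux ut uxx uxt utx utt); try assumption.
        apply C1_on_subset with (3 := HC); unfold Ioo, Icc, Ico; intros; lra. }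
      specialize (He _ _ Is Js).
      assert (Hsum := is_derive_plus (V := R_NormedModule) _ _ _ _ _
        (Hp _ _ _ Ht) (is_derive_scal _ s d _ (Hp _ _ _ Hx))).
      evar_last; [exact Hsum |].
      unfold plus; simpl. rewrite Hm. rewrite <- Hdc in He. lra. }
  unfold phi in Hphi. rewrite Rmult_0_r, Rmult_0_r, !Rplus_0_r in Hphi.
  rewrite Hphi. f_equal. ring.
Qed.

(** Inside the interval, [u] vanishes identically at time 0, hence so does [ux], and [ut] is the
    zero initial velocity. The initial conditions say nothing at the two corners, which are reached
    by continuity. *)
Lemma riemann_initial (c l r T : R) (u ux ut : R -> R -> R) (d x : R) :
  l < r -> 0 < T -> homogeneous_wave c l r T u ux ut -> Icc l r x ->
  riemann ux ut d x 0 = 0.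
Proof.
  intros Hlr HT [HC [_ Hi]] Ix.
  assert (Hin : forall y, l < y < r -> riemann ux ut d y 0 = 0).
  { intros y Iy. destruct (Hi y Iy) as [_ Hv].
    destruct (proj1 HC y 0) as [Hx _]; try (unfold Icc, Ico; lra).
    assert (Hx0 : is_derive (fun z => u z 0) y (ux y 0)).
    { apply (D_in_is_derive (Icc l r) _ (fun z => ux z 0)); [| exact Hx].
      apply filter_imp with (2 := locally_Ioo l r y Iy).
      unfold Ioo, Icc; intros; lra. }
    assert (H0 : is_derive (fun z => u z 0) y 0).
    { apply is_derive_ext_loc with (fun _ => 0);
        [| apply (is_derive_const (V := R_NormedModule))].
      apply filter_imp with (2 := locally_Ioo l r y Iy).
      intros z Iz. symmetry. apply Hi, Iz. }
    unfold riemann. rewrite Hv.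
    rewrite <- (is_derive_unique _ _ _ Hx0), (is_derive_unique _ _ _ H0). ring. }
  (* The segment from [x] to the midpoint lies in the open interval except possibly at its start,
     even when [x] is a corner. *)
  set (m := (l + r) / 2). unfold Icc in Ix.
  set (phi s := riemann ux ut d (x + (m - x) * s) (0 + 0 * s)).
  assert (Hphi : forall s, 0 < s <= 1 -> phi s = 0).
  { intros s Hs. unfold phi. rewrite Rmult_0_l, Rplus_0_r. apply Hin.
    unfold m; split; nra. }
  assert (H01 : phi 0 = phi 1).
  { apply null_derivative_continuous_on; [lra | |].
    - apply continuous_on_riemann with (1 := HC). unfold Icc, Ico, m.
      intros s Hs. split; nra.
    - intros s Hs. apply is_derive_ext_loc with (fun _ => 0);
        [| apply (is_derive_const (V := R_NormedModule))].
      apply filter_imp with (2 := locally_Ioo 0 1 s Hs).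
      intros z Iz. symmetry. apply Hphi. unfold Ioo in Iz; lra. }
  rewrite (Hphi 1) in H01 by lra.
  unfold phi in H01. now rewrite !Rmult_0_r, !Rplus_0_r in H01.
Qed.

(** The backward characteristic meets the initial line no later than it reaches [x + d * tau], hence
    inside [[l, r]] by convexity, and there the invariant is zero. *)
Lemma riemann_early (c l r T : R) (u ux ut : R -> R -> R) (d x t tau : R) :
  l < r -> homogeneous_wave c l r T u ux ut -> d ^ 2 = c ^ 2 -> d <> 0 ->
  Icc l r x -> Icc l r (x + d * tau) -> 0 <= t <= tau -> t < T ->
  riemann ux ut d x t = 0.
Proof.
  intros Hlr Hu Hdc Hd Ix Iy Ht HtT.
  assert (Iz : Icc l r (x + d * t)).
  { unfold Icc in *. destruct (Rdichotomy _ _ Hd); split; nra. }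
  rewrite (riemann_transport c l r T u ux ut d x t t) by (trivial; lra).
  rewrite Rminus_diag.
  apply (riemann_initial c l r T u); trivial. lra.
Qed.

(** * Reflection at the outer boundary *)

Lemma is_derive_trace (c l r T : R) (u ux ut : R -> R -> R) (x t : R) :
  homogeneous_wave c l r T u ux ut -> Icc l r x -> 0 < t < T ->
  is_derive (u x) t (ut x t).
Proof.
  intros [HC _] Ix Ht.
  apply (D_in_is_derive (Ico 0 T)).
  - apply filter_imp with (2 := locally_Ioo 0 T t Ht).
    unfold Ioo, Ico; intros; lra.
  - apply HC; [exact Ix | unfold Ico; lra].
Qed.

(* A homogeneous wave between an interface [x0] and an end point
   [x1 = x0 + d * tau] with zero Dirichlet data; [|d|] is the wave speed, [tau]
   the travel time, and the sign of [d] tells on which side of [x0] the wave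
   lives. *)
Definition reflected_wave (c T d x0 x1 tau : R) (u ux ut : R -> R -> R) : Prop :=
  (exists l r, l < r /\ homogeneous_wave c l r T u ux ut /\
     Icc l r x0 /\ Icc l r x1) /\
  x1 = x0 + d * tau /\ 0 < tau /\ d ^ 2 = c ^ 2 /\ d <> 0 /\
  (forall t, 0 < t < T -> u x1 t = 0).

Lemma reflected_wave_end (c T d x0 x1 tau : R) (u ux ut : R -> R -> R) (t : R) :
  reflected_wave c T d x0 x1 tau u ux ut -> 0 < t < T -> ut x1 t = 0.
Proof.
  intros [(l & r & _ & Hu & _ & I1) (_ & _ & _ & _ & Hb)] Ht.
  rewrite <- (is_derive_unique _ _ _ (is_derive_trace c l r T u ux ut x1 t Hu I1 Ht)).
  apply is_derive_unique, is_derive_ext_loc with (fun _ => 0);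
    [| apply (is_derive_const (V := R_NormedModule))].
  apply filter_imp with (2 := locally_Ioo 0 T t Ht).
  intros s Hs. symmetry. apply Hb, Hs.
Qed.

(** The returning invariant is traced back to the end point [x1]; there [ut = 0], so the invariants
    of speeds [d] and [- d] are opposite; the second is then traced back to [x0]. A round trip lasts
    [2 * tau], and a trace that meets time 0 on the way gives zero. *)
Lemma riemann_reflection (c T d x0 x1 tau : R) (u ux ut : R -> R -> R) (t : R) :
  reflected_wave c T d x0 x1 tau u ux ut -> 0 <= t < T ->
  (t <= 2 * tau -> riemann ux ut d x0 t = 0) /\
  (2 * tau <= t -> riemann ux ut d x0 t = - riemann ux ut (- d) x0 (t - 2 * tau)).
Proof.
  intros Hw Ht.
  assert (Hend := fun t => reflected_wave_end _ _ _ _ _ _ _ _ _ t Hw).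
  destruct Hw as [(l & r & Hlr & Hu & I0 & I1) (Hx1 & Htau & Hdc & Hd & _)].
  assert (Hdc' : (- d) ^ 2 = c ^ 2) by (rewrite <- Hdc; ring).
  assert (Hd' : - d <> 0) by lra.
  assert (Hx0 : x0 = x1 + - d * tau) by lra.
  destruct (Rle_lt_dec t tau) as [Hlt | Hgt].
  { split; intros; [| lra].
    apply riemann_early with (2 := Hu) (tau := tau); trivial; try lra. now rewrite <- Hx1. }
  assert (Hrefl : riemann ux ut d x0 t = - riemann ux ut (- d) x1 (t - tau)).
  { rewrite (riemann_transport c l r T u ux ut d x0 t tau)
      by (rewrite <- ?Hx1; trivial; lra).
    rewrite <- Hx1. unfold riemann. rewrite Hend by lra. ring. }
  rewrite Hrefl. split; intros Htt.
  - rewrite (riemann_early c l r T u ux ut (- d) x1 (t - tau) tau); trivial; try lra.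
    now rewrite <- Hx0.
  - rewrite (riemann_transport c l r T u ux ut (- d) x1 (t - tau) tau)
      by (rewrite <- ?Hx0; trivial; lra).
    rewrite <- Hx0. do 2 f_equal. ring.
Qed.

(** Induction on the number of round trips: the returning invariant is zero or minus the outgoing
    one a round trip earlier, and the interface hypothesis turns a vanishing returning invariant
    into a vanishing outgoing one. *)
Lemma riemann_interface_vanish (c T d x0 x1 tau s : R) (u ux ut : R -> R -> R) :
  reflected_wave c T d x0 x1 tau u ux ut ->
  (forall t, 0 < t < T -> t < s -> riemann ux ut d x0 t = 0 ->
     riemann ux ut (- d) x0 t = 0) ->
  forall t, 0 <= t < T -> t < s -> riemann ux ut (- d) x0 t = 0.
Proof.
  intros Hu Hs.
  assert (Hinit : 0 < T -> riemann ux ut (- d) x0 0 = 0).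
  { intros HT. destruct Hu as [(l & r & Hlr & Hu & I0 & _) _].
    now apply (riemann_initial c l r T u). }
  assert (Hind : forall n t, t <= INR n * (2 * tau) -> 0 <= t < T -> t < s ->
    riemann ux ut (- d) x0 t = 0).
  { induction n as [| n IH]; intros t Hn Ht Hts;
      (destruct (Req_dec t 0) as [-> | Ht0]; [apply Hinit; lra |]).
    - rewrite Rmult_0_l in Hn. lra.
    - apply Hs; [lra | exact Hts |].
      destruct (riemann_reflection _ _ _ _ _ _ _ _ _ t Hu Ht) as [H1 H2].
      destruct (Rle_lt_dec t (2 * tau)) as [Hle | Hgt]; [exact (H1 Hle) |].
      assert (Htau : 0 < tau) by apply Hu.
      rewrite H2, IH; try lra. rewrite S_INR in Hn. lra. }
  intros t Ht Hts.
  assert (Htau : 0 < tau) by apply Hu.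
  (* Finitely many round trips cover any given time, because [tau] is positive. *)
  destruct (INR_unbounded (t / (2 * tau))) as [n Hn].
  apply (Hind n); trivial.
  apply Rmult_gt_compat_r with (r := 2 * tau) in Hn; [| lra].
  unfold Rdiv in Hn. rewrite Rmult_assoc, Rinv_l in Hn by lra. lra.
Qed.

Lemma riemann_interface_delay (c T d x0 x1 tau s : R) (u ux ut : R -> R -> R) :
  reflected_wave c T d x0 x1 tau u ux ut ->
  (forall t, 0 <= t < T -> t < s -> riemann ux ut (- d) x0 t = 0) ->
  forall t, 0 <= t < T -> t < s + 2 * tau -> riemann ux ut d x0 t = 0.
Proof.
  intros Hu Hs t Ht Hts.
  destruct (riemann_reflection _ _ _ _ _ _ _ _ _ t Hu Ht) as [H1 H2].
  destruct (Rle_lt_dec t (2 * tau)) as [Hle | Hgt]; [exact (H1 Hle) |].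
  assert (Htau : 0 < tau) by apply Hu.
  rewrite H2, Hs; lra.
Qed.

(** Inside the subdomain the outgoing invariant is traced back to [x0], and the returning one to
    [x1], where it is minus an outgoing one. Both vanish, so their half sum [ut] does, and [u] keeps
    its zero initial value. *)
Lemma reflected_wave_zero (c T d x0 x1 tau : R) (u ux ut : R -> R -> R) :
  reflected_wave c T d x0 x1 tau u ux ut ->
  (forall t, 0 <= t < T -> riemann ux ut (- d) x0 t = 0) ->
  forall s t, 0 < s < tau -> 0 < t < T -> u (x0 + d * s) t = 0.
Proof.
  intros Hw H0.
  assert (Hend := fun t => reflected_wave_end _ _ _ _ _ _ _ _ _ t Hw).
  destruct Hw as [(l & r & Hlr & Hu & I0 & I1) (Hx1 & Htau & Hdc & Hd & _)].
  assert (Hdc' : (- d) ^ 2 = c ^ 2) by (rewrite <- Hdc; ring).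
  assert (Hcc : forall s, 0 <= s <= tau -> Icc l r (x0 + d * s)).
  { intros s Hs. unfold Icc in *. destruct (Rdichotomy _ _ Hd); split; nra. }
  assert (Hout : forall s t, 0 <= s <= tau -> 0 <= t < T ->
    riemann ux ut (- d) (x0 + d * s) t = 0).
  { intros s t Hs Ht.
    assert (Hx : x0 + d * s + - d * s = x0) by ring.
    destruct (Rle_lt_dec t s).
    - apply riemann_early with (2 := Hu) (tau := s); rewrite ?Hx; auto; lra.
    - rewrite (riemann_transport c l r T u ux ut (- d) _ t s);
        rewrite ?Hx; auto; try lra. apply H0. lra. }
  assert (Hx1t : forall t, 0 <= t < T -> riemann ux ut d x1 t = 0).
  { intros t Ht. destruct (Req_dec t 0) as [-> | Ht0].
    - apply (riemann_initial c l r T u); trivial; lra.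
    - assert (H := Hout tau t ltac:(lra) Ht).
      unfold riemann in *. rewrite <- Hx1, Hend in H by lra.
      rewrite Hend by lra. lra. }
  intros s t Hs Ht.
  set (x := x0 + d * s).
  assert (Hin : forall z, 0 <= z < T -> riemann ux ut d x z = 0).
  { intros z Hz.
    assert (Hx : x + d * (tau - s) = x1) by (unfold x; lra).
    assert (Icx : Icc l r x) by (apply Hcc; lra).
    destruct (Rle_lt_dec z (tau - s)).
    - apply riemann_early with (2 := Hu) (tau := tau - s); rewrite ?Hx; auto; lra.
    - rewrite (riemann_transport c l r T u ux ut d _ z (tau - s));
        rewrite ?Hx; auto; try lra. apply Hx1t. lra. }
  assert (Hut : forall z, 0 <= z < T -> ut x z = 0).
  { intros z Hz. specialize (Hin z Hz). specialize (Hout s z ltac:(lra) Hz).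
    fold x in Hout. unfold riemann in *. lra. }
  assert (Hx : l < x < r).
  { unfold x, Icc in *. destruct (Rdichotomy _ _ Hd); split; nra. }
  (* The target 0 is replaced by the initial value [u x 0], to be compared with [u x t] along the
     time axis. *)
  rewrite <- (proj1 (proj2 (proj2 Hu) x Hx)). symmetry.
  apply null_derivative_continuous_on; [lra | |].
  - apply D_in_continuous_on with (ut x). intros z Hz.
    apply D_in_imp with (Ico 0 T); [unfold Icc, Ico; intros; lra |].
    apply (proj1 Hu); unfold Icc, Ico in *; lra.
  - intros z Hz. rewrite <- (Hut z) by lra.
    apply (is_derive_trace c l r T u ux ut x z Hu); unfold Icc; lra.
Qed.

(** * Error propagation through one iteration *)

(** Superposition with the exact solution, whose flux at the interface is the same from both sides
    and so cancels. The Dirichlet and update conditions are differentiated in time, since the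
    invariants see only derivatives of the traces. *)
Lemma DNWR_step_error (c a b T theta : R) (f g : R -> R -> R) (u0 v0 : R -> R)
    (u : R -> R -> R) (h : R -> R) (u1 u2 : R -> R -> R) (h' : R -> R) :
  0 < c -> 0 < a -> 0 < b -> exact_solution c a b T f g u0 v0 u ->
  DNWR_step c a b T theta f g u0 v0 h u1 u2 h' ->
  exists e1x e1t e2x e2t : R -> R -> R,
    reflected_wave c T (- c) 0 (- a) (a / c) (fun x t => u1 x t - u x t) e1x e1t /\
    reflected_wave c T c 0 b (b / c) (fun x t => u2 x t - u x t) e2x e2t /\
    (forall t, 0 < t < T ->
       e2x 0 t = e1x 0 t /\
       is_derive (fun s => h s - u 0 s) t (e1t 0 t) /\
       is_derive (fun s => h' s - u 0 s) t
         (theta * e2t 0 t + (1 - theta) * e1t 0 t)).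
Proof.
  intros hc ha hb [(ux & ut & Hu) Hg]
    (u1x & u1t & u2x & u2t & H1 & B1 & H2 & B2 & Hh).
  set (e1x x t := u1x x t - ux x t). set (e1t x t := u1t x t - ut x t).
  set (e2x x t := u2x x t - ux x t). set (e2t x t := u2t x t - ut x t).
  assert (E1 : homogeneous_wave c (- a) 0 T (fun x t => u1 x t - u x t) e1x e1t).
  { apply (wave_solution_minus _ _ _ _ _ _ _ _ _ _ _ _ _ H1).
    apply (wave_solution_restrict c (- a) b); trivial; lra. }
  assert (E2 : homogeneous_wave c 0 b T (fun x t => u2 x t - u x t) e2x e2t).
  { apply (wave_solution_minus _ _ _ _ _ _ _ _ _ _ _ _ _ H2).
    apply (wave_solution_restrict c (- a) b); trivial; lra. }
  exists e1x, e1t, e2x, e2t. split; [| split].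
  - refine (conj _ (conj _ (conj _ (conj _ (conj _ _))))).
    + exists (- a), 0. unfold Icc. refine (conj _ (conj E1 (conj _ _))); lra.
    + field. lra.
    + apply Rdiv_lt_0_compat; assumption.
    + ring.
    + lra.
    + intros t Ht. rewrite (proj1 (B1 t Ht)), (proj1 (Hg t Ht)). ring.
  - refine (conj _ (conj _ (conj _ (conj _ (conj _ _))))).
    + exists 0, b. unfold Icc. refine (conj _ (conj E2 (conj _ _))); lra.
    + field. lra.
    + apply Rdiv_lt_0_compat; assumption.
    + ring.
    + lra.
    + intros t Ht. rewrite (proj2 (B2 t Ht)), (proj2 (Hg t Ht)). ring.
  - intros t Ht.
    assert (D1 := is_derive_trace _ _ _ _ _ _ _ 0 t E1 ltac:(unfold Icc; lra) Ht).
    assert (D2 := is_derive_trace _ _ _ _ _ _ _ 0 t E2 ltac:(unfold Icc; lra) Ht).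
    split; [| split].
    + unfold e1x, e2x. rewrite (proj1 (B2 t Ht)). reflexivity.
    + apply is_derive_ext_loc with (2 := D1).
      apply filter_imp with (2 := locally_Ioo 0 T t Ht).
      intros s Hs. simpl. rewrite (proj2 (B1 s Hs)). reflexivity.
    + assert (D := is_derive_plus (V := R_NormedModule) _ _ _ _ _
        (is_derive_scal _ t theta _ D2) (is_derive_scal _ t (1 - theta) _ D1)).
      apply is_derive_ext_loc with (2 := D).
      apply filter_imp with (2 := locally_Ioo 0 T t Ht).
      intros s Hs. rewrite (Hh s Hs). unfold plus; simpl.
      rewrite (proj2 (B1 s Hs)). refine (_ : @eq R _ _). ring.
Qed.

(* With [d = - c] on the left, the outgoing invariants are those of speed
   [- - c] for [e1] and [- c] for [e2]. *)
Lemma DNWR_errors_vanish (c a b T s : R) (e1 e1x e1t e2 e2x e2t : R -> R -> R) :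
  reflected_wave c T (- c) 0 (- a) (a / c) e1 e1x e1t ->
  reflected_wave c T c 0 b (b / c) e2 e2x e2t ->
  (forall t, 0 < t < T -> e2x 0 t = e1x 0 t) ->
  (forall t, 0 < t < T -> t < s -> e1t 0 t = 0) ->
  (forall t, 0 <= t < T -> t < s -> riemann e1x e1t (- - c) 0 t = 0) /\
  (forall t, 0 <= t < T -> t < s -> riemann e2x e2t (- c) 0 t = 0).
Proof.
  intros W1 W2 Hx Ht.
  assert (R1 : forall t, 0 <= t < T -> t < s -> riemann e1x e1t (- - c) 0 t = 0).
  { apply (riemann_interface_vanish _ _ _ _ _ _ _ _ _ _ W1). intros t Ht1 Hts.
    (* Dirichlet side: with [e1t = 0] the two invariants are opposite multiples of the flux, so they
       vanish together. *)
    unfold riemann. rewrite (Ht t Ht1 Hts). lra. }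
  split; [exact R1 |].
  apply (riemann_interface_vanish _ _ _ _ _ _ _ _ _ _ W2). intros t Ht1 Hts.
  assert (Hc : c <> 0) by apply W2.
  assert (H1 := R1 t ltac:(lra) Hts).
  unfold riemann in *. rewrite (Ht t Ht1 Hts) in H1.
  rewrite (Hx t Ht1).
  (* Neumann side: the outgoing invariant of [e1] and [e1t] both vanish, hence so does the common
     flux, and the two invariants of [e2] then both equal [e2t]. *)
  assert (e1x 0 t = 0) as -> by nra. lra.
Qed.

Lemma DNWR_step_trace (c a b T : R) (f g : R -> R -> R) (u0 v0 : R -> R)
    (u : R -> R -> R) (h : R -> R) (u1 u2 : R -> R -> R) (h' : R -> R) (s : R) :
  0 < c -> 0 < a -> 0 < b -> exact_solution c a b T f g u0 v0 u ->
  DNWR_step c a b T (1 / 2) f g u0 v0 h u1 u2 h' ->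
  (forall t, 0 < t < T -> t < s -> is_derive (fun z => h z - u 0 z) t 0) ->
  forall t, 0 < t < T -> t < s + 2 * Rmin (a / c) (b / c) ->
  is_derive (fun z => h' z - u 0 z) t 0.
Proof.
  intros hc ha hb hu Hstep Hs.
  destruct (DNWR_step_error _ _ _ _ _ _ _ _ _ _ _ _ _ _ hc ha hb hu Hstep)
    as (e1x & e1t & e2x & e2t & W1 & W2 & Hi).
  destruct (DNWR_errors_vanish _ _ _ _ s _ _ _ _ _ _ W1 W2) as [R1 R2].
  - intros t Ht. apply Hi, Ht.
  - intros t Ht Hts. destruct (Hi t Ht) as (_ & Hd & _).
    rewrite <- (is_derive_unique _ _ _ Hd). apply is_derive_unique. auto.
  - intros t Ht Hts. destruct (Hi t Ht) as (Hx & _ & Hd).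
    assert (Ha := Rmin_l (a / c) (b / c)). assert (Hb := Rmin_r (a / c) (b / c)).
    assert (I1 := riemann_interface_delay _ _ _ _ _ _ _ _ _ _ W1 R1 t ltac:(lra) ltac:(lra)).
    assert (I2 := riemann_interface_delay _ _ _ _ _ _ _ _ _ _ W2 R2 t ltac:(lra) ltac:(lra)).
    (* The returning invariants are [e1t - c * e1x] and [e2t + c * e2x]; with equal fluxes their sum
       is [e1t + e2t], twice the derivative of the updated trace. *)
    unfold riemann in I1, I2. rewrite Hx in I2.
    evar_last; [exact Hd |]. refine (_ : @eq R _ _). lra.
Qed.

(** With a stationary interface error over the whole window the outgoing invariants vanish up to
    [T], and [reflected_wave_zero] then applies on each side. *)
Lemma DNWR_step_exact (c a b T theta : R) (f g : R -> R -> R) (u0 v0 : R -> R)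
    (u : R -> R -> R) (h : R -> R) (u1 u2 : R -> R -> R) (h' : R -> R) :
  0 < c -> 0 < a -> 0 < b -> exact_solution c a b T f g u0 v0 u ->
  DNWR_step c a b T theta f g u0 v0 h u1 u2 h' ->
  (forall t, 0 < t < T -> is_derive (fun z => h z - u 0 z) t 0) ->
  (forall x t, - a < x < 0 -> 0 < t < T -> u1 x t = u x t) /\
  (forall x t, 0 < x < b -> 0 < t < T -> u2 x t = u x t).
Proof.
  intros hc ha hb hu Hstep Hs.
  destruct (DNWR_step_error _ _ _ _ _ _ _ _ _ _ _ _ _ _ hc ha hb hu Hstep)
    as (e1x & e1t & e2x & e2t & W1 & W2 & Hi).
  destruct (DNWR_errors_vanish _ _ _ _ T _ _ _ _ _ _ W1 W2) as [R1 R2].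
  - intros t Ht. apply Hi, Ht.
  - intros t Ht _. destruct (Hi t Ht) as (_ & Hd & _).
    rewrite <- (is_derive_unique _ _ _ Hd). apply is_derive_unique. auto.
  - assert (Hdiv : forall y z, y < z -> y / c < z / c).
    { intros y z Hyz. apply Rmult_lt_compat_r; [apply Rinv_0_lt_compat, hc | exact Hyz]. }
    split; intros x t Hx Ht.
    (* The parameter [- x / c] is the travel time from the interface to [x], as is [x / c] on the
       right. *)
    + assert (E := reflected_wave_zero _ _ _ _ _ _ _ _ _ W1
        (fun t Ht => R1 t Ht (proj2 Ht)) (- x / c) t).
      replace (0 + - c * (- x / c)) with x in E by (field; lra).
      apply Rminus_diag_uniq, E; [| exact Ht].
      split; [apply Rdiv_lt_0_compat | apply Hdiv]; lra.
    + assert (E := reflected_wave_zero _ _ _ _ _ _ _ _ _ W2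
        (fun t Ht => R2 t Ht (proj2 Ht)) (x / c) t).
      replace (0 + c * (x / c)) with x in E by (field; lra).
      apply Rminus_diag_uniq, E; [| exact Ht].
      split; [apply Rdiv_lt_0_compat | apply Hdiv]; lra.
Qed.

Theorem theorem2 (c a b T : R) (k : nat)
    (f g : R -> R -> R) (u0 v0 : R -> R) (u : R -> R -> R)
    (hc : 0 < c) (ha : 0 < a) (hb : 0 < b) (hab : a <> b)
    (hk : (1 <= k)%nat) (hT : 0 < T)
    (hTk : T / INR k <= 2 * Rmin (a / c) (b / c))
    (hu : exact_solution c a b T f g u0 v0 u) :
  DNWR_converges_in_at_most (k + 1) c a b T (1 / 2) f g u0 v0 u.
Proof.
  intros h u1 u2 Hstep.
  assert (Htrace : forall j, (j <= k)%nat -> forall t, 0 < t < T ->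
    t < INR j * (2 * Rmin (a / c) (b / c)) ->
    is_derive (fun z => h j z - u 0 z) t 0).
  { induction j as [| j IH]; intros Hj t Ht Hjt.
    (* Nothing is known about the initial guess: for [j = 0] the covered window is empty. *)
    - rewrite Rmult_0_l in Hjt. lra.
    - assert (Hs := Hstep (S j) ltac:(lia)).
      replace (S j - 1)%nat with j in Hs by lia.
      apply (DNWR_step_trace _ _ _ _ _ _ _ _ _ _ _ _ _ _ hc ha hb hu Hs (IH ltac:(lia)));
        [exact Ht |].
      rewrite S_INR in Hjt. lra. }
  assert (Hs := Hstep (k + 1)%nat ltac:(lia)).
  replace (k + 1 - 1)%nat with k in Hs by lia.
  apply (DNWR_step_exact _ _ _ _ _ _ _ _ _ _ _ _ _ _ hc ha hb hu Hs).
  (* Iteration [k + 1] starts from [h k], whose error is stationary on the whole window because [T]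
     is at most [k] times the gain per iteration. *)
  intros t Ht. apply Htrace; [lia | exact Ht |].
  assert (Hk : 0 < INR k) by (apply lt_0_INR; lia).
  apply Rmult_le_compat_r with (r := INR k) in hTk; [| lra].
  unfold Rdiv at 1 in hTk. rewrite Rmult_assoc, Rinv_l in hTk by lra. lra.
Qed.
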